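(* Let $R$ be a commutative ring with identity, let $(Y,y_0,k_Y,m_Y)$ be a digital Hopf space with digital multiplication $m_Y:Y\times Y\to Y$, let $(X,x_0,k_X)$ be a pointed digital image, and let $f,g:(X,x_0)\to(Y,y_0)$ be pointed $(k_X,k_Y)$-continuous functions. If $y\in dH^*(Y;R)$ is a digital primitive cohomology class, then $$([f]\boxplus[g])^*(y)=f^*(y)+g^*(y),$$ where $f^*,g^*:dH^*(Y;R)\to dH^*(X;R)$ are the homomorphisms induced by $f$ and $g$, and $([f]\boxplus[g])^*$ is the homomorphism induced by $f\boxplus g=m_Y\circ(f\times g)\circ\Delta$.
   Context: A digital image is a pair $(X,k_X)$ where $X$ is a finite subset of some $\mathbb{Z}^n$ and $k_X$ is an adjacency relation (symmetric, irreflexive) on $X$. The basic examples are the $k(u,n)$-adjacencies, $1\le u\le n$: distinct $p,q\in\mathbb{Z}^n$ are $k(u,n)$-adjacent if $|p_i-q_i|=1$ for at most $u$ indices $i$ and $p_j=q_j$ for all other indices $j$. A subset $A\subseteq X$ is $k_X$-connected if any two distinct points of $A$ are joined by a finite sequence of distinct points of $A$ in which consecutive points are $k_X$-adjacent. A function $f:X\to Y$ is $(k_X,k_Y)$-continuous if it sends every $k_X$-connected subset of $X$ to a $k_Y$-connected subset of $Y$. A pointed digital image $(X,x_0,k_X)$ has a chosen base point $x_0\in X$; pointed functions preserve base points. Homotopy: a digital $(k_X,k_Y)$-homotopy between continuous $f,g:X\to Y$ is a function $F:X\times[0,m]_{\mathbb{Z}}\to Y$ for some positive integer $m$, where $[0,m]_{\mathbb{Z}}=\{0,1,\dots,m\}$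 has 2-adjacency (consecutive integers), with $F(x,0)=f(x)$, $F(x,m)=g(x)$, each $F(x,\cdot):[0,m]_{\mathbb{Z}}\to Y$ being $(2,k_Y)$-continuous and each $F(\cdot,t):X\to Y$ being $(k_X,k_Y)$-continuous. It is pointed if $F(x_0,t)=y_0$ for all $t$. $[f]$ denotes the pointed digital homotopy class of $f$. Products: the Cartesian product $X\times Y$ of digital images is regarded as a digital image with an adjacency relation $k_{X\times Y}$ for which coordinate inclusions, projections, diagonal maps, switching maps and products $f\times g$ of continuous functions are continuous. Digital Hopf space $(Y,y_0,k_Y,m_Y)$: a pointed digital image $(Y,y_0,k_Y)$ with a $(k_{Y\times Y},k_Y)$-continuous $m_Y:Y\times Y\to Y$ (digital multiplication) such that $y\mapsto m_Y(y_0,y)$ and $y\mapsto m_Y(y,y_0)$ are both pointed digitally homotopic to $1_Y$. The digital convolution is $[f]\boxplus[g]=[f\boxplus g]$, $f\boxplus g=m_Y\circ(f\times g)\circ\Delta$, where $\Delta:X\to X\times X$ is the diagonal. Cohomology: $\Delta^n=\{e_0,\dots,e_n\}\subset\mathbb{Z}^{n+1}$ (standard basis vectors, ordered by index) with $k(2,n+1)$-adjacency, so any two distinct points are adjacent. $dC_n(X;R)$ is the free $R$-module on all continuous functions $\sigma:\Delta^n\to X$; $\partial_n\sigma=\sum_{i=0}^n(-1)^i\sigma\circ\epsilon_i^n$ for $n\ge1$, where $\epsilon_i^n:\Delta^{n-1}\to\Delta^n$ is the order-preserving injection omitting $e_i$; $\partial_0=0$. $dH^n(X;R)$ is the $n$th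 cohomology of the cochain complex $\operatorname{Hom}_R(dC_*(X;R),R)$; a continuous $f:X\to Y$ induces $f^*:dH^*(Y;R)\to dH^*(X;R)$ by dualizing the chain map $\sigma\mapsto f\circ\sigma$. A class $y\in dH^*(Y;R)$ is a digital primitive cohomology class if $m_Y^*(y)=p_1^*(y)+p_2^*(y)$, where $p_1,p_2:Y\times Y\to Y$ are the first and second projections. *)

(* Defs.v *)
From HB Require Import structures.
From mathcomp Require Import all_boot all_order all_algebra finmap.
From mathcomp Require Import boolp functions.

Set Implicit Arguments.
Unset Strict Implicit.
Unset Printing Implicit Defensive.

Import GRing.Theory Num.Theory.
Local Open Scope fset_scope.
Local Open Scope ring_scope.
Local Open Scope quotient_scope.

Record digImg := DigImg {
  ddim : nat;
  pts :> {fset 'rV[int]_ddim};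
  adj : rel pts;
  adj_sym : symmetric adj;
  adj_irr : irreflexive adj }.

Definition kadj (u n : nat) (p q : 'rV[int]_n) : bool :=
  [&& p != q,
      (#|[pred i | `|p 0 i - q 0 i| == 1]%R| <= u)%N &
      [forall i, (`|p 0 i - q 0 i| != 1) ==> (p 0 i == q 0 i)]].

Lemma kadj_sym u n : symmetric (@kadj u n).
Proof.
move=> p q; rewrite /kadj eq_sym; congr [&& _, _ & _].
  by congr (_ <= _)%N; apply: eq_card => i; rewrite !inE distrC.
by apply: eq_forallb => i; rewrite distrC [p 0 i == _]eq_sym.
Qed.

Lemma kadj_irr u n : irreflexive (@kadj u n).
Proof. by move=> p; rewrite /kadj eqxx. Qed.

Definition kimg (u n : nat) (A : {fset 'rV[int]_n}) : digImg :=
  @DigImg n A (fun p q => kadj u (val p) (val q))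
    (fun p q => kadj_sym u (val p) (val q)) (fun p => kadj_irr u (val p)).

Definition dconnected (X : digImg) (A : {set X}) : Prop :=
  forall a b : X, a \in A -> b \in A -> a != b ->
  exists s : seq X, [/\ path (@adj X) a s, last a s = b,
    uniq (a :: s) & {subset a :: s <= A}].

Definition dcont (X Y : digImg) (f : X -> Y) : Prop :=
  forall A : {set X}, dconnected A -> dconnected (f @: A).

Lemma dcont_comp (X Y Z : digImg) (g : Y -> Z) (f : X -> Y) :
  dcont g -> dcont f -> dcont (g \o f).
Proof. by move=> cg cf A cA; rewrite imset_comp; apply/cg/cf. Qed.

Lemma eq_dcont (X Y : digImg) (f g : X -> Y) : f =1 g -> dcont f -> dcont g.
Proof. by move=> fg cf A cA; rewrite -(eq_imset _ fg); apply: cf. Qed.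

Record cmap (X Y : digImg) := CMap {
  cmap_val :> {ffun X -> Y};
  cmap_valP : `[< dcont cmap_val >] }.

HB.instance Definition _ X Y := [isSub for @cmap_val X Y].
HB.instance Definition _ X Y := [Finite of cmap X Y by <:].

Lemma cmap_cont (X Y : digImg) (f : cmap X Y) : dcont f.
Proof. exact/asboolP/cmap_valP. Qed.
Arguments cmap_cont {X Y} f.

Lemma cmapP (X Y : digImg) (f g : cmap X Y) : f =1 g -> f = g.
Proof. by move=> fg; apply/val_inj/ffunP. Qed.

Lemma mkcmap_subproof (X Y : digImg) (f : X -> Y) :
  dcont f -> `[< dcont (finfun f) >].
Proof. by move=> cf; apply/asboolP; apply: eq_dcont cf => x; rewrite ffunE. Qed.

Definition mkcmap (X Y : digImg) (f : X -> Y) (cf : dcont f) : cmap X Y :=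
  CMap (mkcmap_subproof cf).

Lemma mkcmapE (X Y : digImg) (f : X -> Y) (cf : dcont f) : mkcmap cf =1 f.
Proof. by move=> x; rewrite ffunE. Qed.

Definition ccomp (X Y Z : digImg) (g : cmap Y Z) (f : cmap X Y) : cmap X Z :=
  mkcmap (dcont_comp (cmap_cont g) (cmap_cont f)).

Lemma ccompE (X Y Z : digImg) (g : cmap Y Z) (f : cmap X Y) x :
  ccomp g f x = g (f x).
Proof. exact: mkcmapE. Qed.

(** The "2-adjacency" of consecutive integers is [k(1,1)]. *)
Definition dint (m : nat) : digImg :=
  kimg 1 [fset (const_mx (nat_of_ord t)%:Z : 'rV[int]_1) | t in 'I_m.+1].

Lemma dint_pt_subproof m (t : 'I_m.+1) :
  (const_mx (nat_of_ord t)%:Z : 'rV[int]_1) \in (dint m : {fset _}).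
Proof. exact: in_imfset. Qed.

Definition dint_pt m (t : 'I_m.+1) : dint m := [` dint_pt_subproof t].

Definition phomotopic (X Y : digImg) (x0 : X) (y0 : Y) (f g : X -> Y) : Prop :=
  exists (m : nat) (F : X * dint m -> Y), (0 < m)%N /\
    [/\ forall x, F (x, dint_pt ord0) = f x,
        forall x, F (x, dint_pt ord_max) = g x,
        forall x, dcont (fun t => F (x, t)),
        forall t, dcont (fun x => F (x, t)) &
        forall t, F (x0, t) = y0].

Definition prod_pts (X Y : digImg) : {fset 'rV[int]_(ddim X + ddim Y)} :=
  [fset row_mx x y | x in pts X, y in pts Y].

Section ProductPoints.
Variables X Y : digImg.

Lemma ppair_subproof (x : X) (y : Y) :
  row_mx (val x) (val y) \in prod_pts X Y.
Proof. by apply: in_imfset2; apply: valP. Qed.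

Lemma pfst_subproof (z : prod_pts X Y) : lsubmx (val z) \in pts X.
Proof.
by case: z => z /= /imfset2P[x xX [y _ ->]]; rewrite row_mxKl.
Qed.

Lemma psnd_subproof (z : prod_pts X Y) : rsubmx (val z) \in pts Y.
Proof.
by case: z => z /= /imfset2P[x _ [y yY ->]]; rewrite row_mxKr.
Qed.

Definition ppair (x : X) (y : Y) : prod_pts X Y := [` ppair_subproof x y].
Definition pfst (z : prod_pts X Y) : X := [` pfst_subproof z].
Definition psnd (z : prod_pts X Y) : Y := [` psnd_subproof z].

Lemma ppairK1 x y : pfst (ppair x y) = x.
Proof. by apply: val_inj; rewrite /= row_mxKl. Qed.

Lemma ppairK2 x y : psnd (ppair x y) = y.
Proof. by apply: val_inj; rewrite /= row_mxKr. Qed.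

Lemma ppairE z : ppair (pfst z) (psnd z) = z.
Proof. by apply: val_inj; rewrite /= hsubmxK. Qed.

End ProductPoints.

Record prodRel := ProdRel {
  padj : forall X Y : digImg, rel (prod_pts X Y);
  padj_sym : forall X Y, symmetric (@padj X Y);
  padj_irr : forall X Y, irreflexive (@padj X Y) }.

Definition pimg (k : prodRel) (X Y : digImg) : digImg :=
  DigImg (@padj_sym k X Y) (@padj_irr k X Y).

(** No specific product adjacency is fixed: any simultaneous choice on all
    pairs of images making the structure maps below continuous is allowed. *)
Record prodAdj := ProdAdj {
  prodAdj_rel :> prodRel;
  pinl_cont : forall (X Y : digImg) (y : Y),
    dcont (fun x : X => ppair x y : pimg prodAdj_rel X Y);
  pinr_cont : forall (X Y : digImg) (x : X),
    dcont (fun y : Y => ppair x y : pimg prodAdj_rel X Y);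
  pfst_cont : forall X Y : digImg,
    dcont (fun z : pimg prodAdj_rel X Y => pfst z);
  psnd_cont : forall X Y : digImg,
    dcont (fun z : pimg prodAdj_rel X Y => psnd z);
  pdiag_cont : forall X : digImg,
    dcont (fun x : X => ppair x x : pimg prodAdj_rel X X);
  pswitch_cont : forall X Y : digImg,
    dcont (fun z : pimg prodAdj_rel X Y =>
             ppair (psnd z) (pfst z) : pimg prodAdj_rel Y X);
  pmap_cont : forall (X X' Y Y' : digImg) (f : X -> X') (g : Y -> Y'),
    dcont f -> dcont g ->
    dcont (fun z : pimg prodAdj_rel X Y =>
             ppair (f (pfst z)) (g (psnd z)) : pimg prodAdj_rel X' Y') }.

Section ProductMaps.
Variable k : prodAdj.

Definition cfst X Y : cmap (pimg k X Y) X := mkcmap (@pfst_cont k X Y).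
Definition csnd X Y : cmap (pimg k X Y) Y := mkcmap (@psnd_cont k X Y).
Definition cdiag X : cmap X (pimg k X X) := mkcmap (@pdiag_cont k X).
Definition cprod X X' Y Y' (f : cmap X X') (g : cmap Y Y') :
    cmap (pimg k X Y) (pimg k X' Y') :=
  mkcmap (pmap_cont (p := k) (cmap_cont f) (cmap_cont g)).

End ProductMaps.

Record digital_hopf_space (k : prodAdj) (Y : digImg) (y0 : Y)
    (mY : cmap (pimg k Y Y) Y) : Prop := DigitalHopfSpace {
  hopf_unitl : phomotopic y0 y0 (fun y => mY (ppair y0 y)) id;
  hopf_unitr : phomotopic y0 y0 (fun y => mY (ppair y y0)) id }.

(** The representative [mY o (f x g) o diag] of the class [[f] [+] [g]].
    Induced maps on cohomology are those of this representative. *)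
Definition convolution (k : prodAdj) (X Y : digImg)
    (mY : cmap (pimg k Y Y) Y) (f g : cmap X Y) : cmap X Y :=
  ccomp mY (ccomp (cprod k f g) (cdiag k X)).

Definition dsimplex (n : nat) : digImg :=
  kimg 2 [fset (delta_mx 0 i : 'rV[int]_n.+1) | i in 'I_n.+1].

Lemma vtx_subproof n (i : 'I_n.+1) :
  (delta_mx 0 i : 'rV[int]_n.+1) \in (dsimplex n : {fset _}).
Proof. exact: in_imfset. Qed.

Definition vtx n (i : 'I_n.+1) : dsimplex n := [` vtx_subproof i].

Definition vidx n (p : dsimplex n) : 'I_n.+1 :=
  odflt ord0 [pick i | vtx i == p].

Lemma vtx_inj n : injective (@vtx n).
Proof.
move=> i j /(congr1 val) /= /matrixP /(_ 0 i).
by rewrite !mxE !eqxx /=; case: eqP => [->|].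
Qed.

Lemma vidxK n : cancel (@vidx n) (@vtx n).
Proof.
move=> p; rewrite /vidx; case: pickP => [i /eqP //|np].
case: p np => p pS np; case/imfsetP: (pS) => i _ pE.
by have := np i; rewrite -val_eqE /= -pE eqxx.
Qed.

Lemma vtxK n : cancel (@vtx n) (@vidx n).
Proof. by move=> i; apply: vtx_inj; rewrite vidxK. Qed.

Lemma dsimplex_adj n (p q : dsimplex n) : p != q -> adj p q.
Proof.
rewrite -(vidxK p) -(vidxK q); set i := vidx p; set j := vidx q.
rewrite (inj_eq (@vtx_inj n)) => ij.
have E l : (delta_mx 0 i : 'rV[int]_n.+1) 0 l
    - (delta_mx 0 j : 'rV[int]_n.+1) 0 l = (l == i)%:R - (l == j)%:R.
  by rewrite !mxE !eqxx.
apply/and3P; split.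
- by rewrite val_eqE (inj_eq (@vtx_inj n)).
- apply: leq_trans (_ : #|[set i; j]| <= 2)%N; last by rewrite cards2 ij.
  apply: subset_leq_card; apply/subsetP => l; rewrite !inE /= E.
  by case: (l == i); case: (l == j).
- apply/forallP => l; apply/implyP; rewrite /= E !mxE !eqxx /=.
  by case: (l == i); case: (l == j).
Qed.

Lemma dcont_to_simplex (X : digImg) n (f : X -> dsimplex n) : dcont f.
Proof.
move=> A _ a b aA bA ab; exists [:: b]; split => //=.
- by rewrite andbT; apply: dsimplex_adj.
- by rewrite inE ab.
- by move=> c; rewrite !inE => /orP[] /eqP ->.
Qed.

Definition face n (i : 'I_n.+2) : cmap (dsimplex n) (dsimplex n.+1) :=
  mkcmap (@dcont_to_simplex _ _ (fun p => vtx (lift i (vidx p)))).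

Lemma faceE n (i : 'I_n.+2) (j : 'I_n.+1) : face i (vtx j) = vtx (lift i j).
Proof. by rewrite mkcmapE vtxK. Qed.

Section FreeModule.
Variables (R : comPzRingType) (S : finType).

(** [S] is finite, so the free module on [S] is the module of all
    functions [S -> R]. *)
Definition freemod := {ffun S -> R^o}.
HB.instance Definition _ := GRing.Lmodule.on freemod.

Definition fbasis (s : S) : freemod := [ffun t => (t == s)%:R].

Definition flift (V : lmodType R) (h : S -> V) (c : freemod) : V :=
  \sum_s (c s : R) *: h s.

Lemma flift_is_linear (V : lmodType R) (h : S -> V) : linear (flift h).
Proof.
move=> a c d; rewrite /flift scaler_sumr -big_split /=.
by apply: eq_bigr => s _; rewrite !ffunE scalerDl scalerA.
Qed.

HB.instance Definition _ (V : lmodType R) (h : S -> V) :=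
  GRing.isLinear.Build R freemod V *:%R (flift h) (flift_is_linear h).

Lemma flift_basis (V : lmodType R) (h : S -> V) s : flift h (fbasis s) = h s.
Proof.
rewrite /flift (bigD1 s) //= ffunE eqxx scale1r big1 ?addr0 // => t ts.
by rewrite ffunE (negPf ts) scale0r.
Qed.

Lemma fbasis_sum (c : freemod) : c = \sum_s (c s : R) *: fbasis s.
Proof.
apply/ffunP => t; rewrite sum_ffunE (bigD1 t) //= big1 ?addr0.
  by rewrite !ffunE eqxx [RHS]mulr1.
by move=> s st; rewrite !ffunE eq_sym (negPf st) [LHS]mulr0.
Qed.

Lemma free_ext (V : lmodType R) (f g : {linear freemod -> V}) :
  (forall s, f (fbasis s) = g (fbasis s)) -> f =1 g.
Proof.
move=> fg c; rewrite (fbasis_sum c) !linear_sum.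
by apply: eq_bigr => s _; rewrite !linearZ fg.
Qed.

End FreeModule.

Section Dual.
Variables (R : comPzRingType) (U : lmodType R).

Definition linear_pred : {pred U -> R^o} := fun f => `[< linear f >].

Lemma linear_pred_closed : submod_closed linear_pred.
Proof.
split=> [|a f g /asboolP fl /asboolP gl]; apply/asboolP.
  by move=> b u v; change (0 = b *: 0 + 0 :> R^o); rewrite scaler0 addr0.
move=> b u v; rewrite -[LHS]/(a *: f _ + g _) fl gl.
rewrite -[(a *: f + g) u]/(a *: f u + g u) -[(a *: f + g) v]/(a *: f v + g v).
rewrite !scalerDr !scalerA (mulrC a b) -!addrA; congr (_ + _).
by rewrite addrCA.
Qed.

HB.instance Definition _ :=
  GRing.isSubmodClosed.Build R (U -> R^o) linear_pred linear_pred_closed.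

Record dual := Dual {
  dual_val :> U -> R^o;
  dual_valP : dual_val \in linear_pred }.

HB.instance Definition _ := [isSub for dual_val].
HB.instance Definition _ := [Choice of dual by <:].
HB.instance Definition _ := [SubChoice_isSubLmodule of dual by <:].

Lemma dual_linear (f : dual) : linear f.
Proof. exact/asboolP/dual_valP. Qed.

HB.instance Definition _ (f : dual) :=
  GRing.isLinear.Build R U R^o *:%R (dual_val f) (dual_linear f).

Lemma dualP (f g : dual) : f =1 g -> f = g.
Proof. by move=> fg; apply/val_inj/funext. Qed.

End Dual.

Section DualMap.
Variables (R : comPzRingType) (U V : lmodType R) (h : {linear U -> V}).

Lemma dual_map_subproof (f : dual V) :
  (f \o h : U -> R^o) \in @linear_pred R U.
Proof. by apply/asboolP; apply: linearP. Qed.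

Definition dual_map (f : dual V) : dual U := Dual (dual_map_subproof f).

Lemma dual_map_is_linear : linear dual_map.
Proof. by move=> a f g; apply: dualP. Qed.

HB.instance Definition _ :=
  GRing.isLinear.Build R (dual V) (dual U) *:%R dual_map dual_map_is_linear.

End DualMap.

Section QuotientModule.
Variables (R : pzRingType) (V : lmodType R) (S : submodClosed V).

(** A copy of [S]: the library derives no [zmodClosed] structure from
    [submodClosed], although [-1] acts by scaling. *)
Definition submod_pred : {pred V} := fun v => v \in S.

Lemma submod_pred_closed : zmod_closed submod_pred.
Proof. exact/GRing.submod_closedB/submodClosedP. Qed.

HB.instance Definition _ :=
  GRing.isZmodClosed.Build V submod_pred submod_pred_closed.

Definition quotmod := Quotient.quot submod_pred.
HB.instance Definition _ := GRing.Zmodule.on quotmod.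

Definition qproj (v : V) : quotmod := \pi_(Quotient.quot submod_pred) v.

Lemma qproj_is_additive : zmod_morphism qproj.
Proof. exact: raddfB. Qed.

HB.instance Definition _ :=
  GRing.isZmodMorphism.Build V quotmod qproj qproj_is_additive.

Definition qrepr (c : quotmod) : V := repr (c : Quotient.quot submod_pred).

Lemma qreprK : cancel qrepr qproj.
Proof. exact: reprK. Qed.

Lemma qprojP (v w : V) : reflect (qproj v = qproj w) (v - w \in S).
Proof. by apply: (iffP idP) => [vwS|/eqP]; [apply/eqP|]; rewrite -Quotient.idealrBE. Qed.

Definition qscale (a : R) (c : quotmod) : quotmod := qproj (a *: qrepr c).

Lemma qscaleE a v : qscale a (qproj v) = qproj (a *: v).
Proof. by apply/qprojP; rewrite -scalerBr rpredZ //; apply/qprojP/qreprK. Qed.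

Lemma qscaleA a b c : qscale a (qscale b c) = qscale (a * b) c.
Proof. by rewrite -(qreprK c) !qscaleE scalerA. Qed.

Lemma qscale1 : left_id 1 qscale.
Proof. by move=> c; rewrite -(qreprK c) qscaleE scale1r. Qed.

Lemma qscaleDr : right_distributive qscale +%R.
Proof.
move=> a c d; rewrite -(qreprK c) -(qreprK d) -raddfD !qscaleE scalerDr.
exact: raddfD.
Qed.

Lemma qscaleDl c : {morph qscale^~ c : a b / a + b}.
Proof.
by move=> a b; rewrite -(qreprK c) !qscaleE scalerDl; apply: raddfD.
Qed.

HB.instance Definition _ := GRing.Zmodule_isLmodule.Build R quotmod
  qscaleA qscale1 qscaleDr qscaleDl.

Lemma qproj_scalable : scalable qproj.
Proof. by move=> a v; rewrite -qscaleE. Qed.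

HB.instance Definition _ :=
  GRing.isScalable.Build R V quotmod *:%R qproj qproj_scalable.

End QuotientModule.

Section DirectSum.
Variables (R : pzRingType) (V : nat -> lmodType R).

Definition finsupp_seq (c : forall n, V n) : Prop :=
  exists N, forall n, (N <= n)%N -> c n = 0.

Record dirsum := DirSum {
  dcomp :> forall n, V n;
  dcompP : finsupp_seq dcomp }.

Lemma dirsumP (c d : dirsum) : (forall n, c n = d n) -> c = d.
Proof.
case: c d => [c cP] [d dP] /= cd.
have {}cd : c = d by apply: functional_extensionality_dep.
by case: _ / cd dP => dP; congr DirSum; apply: Prop_irrelevance.
Qed.

HB.instance Definition _ := gen_eqMixin dirsum.
HB.instance Definition _ := gen_choiceMixin dirsum.

Lemma dzero_subproof : finsupp_seq (fun n => 0 : V n).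
Proof. by exists 0%N. Qed.

Lemma dadd_subproof (c d : dirsum) : finsupp_seq (fun n => c n + d n).
Proof.
have [[N cN] [M dM]] := (dcompP c, dcompP d).
by exists (maxn N M) => n; rewrite geq_max => /andP[/cN -> /dM ->]; rewrite addr0.
Qed.

Lemma dopp_subproof (c : dirsum) : finsupp_seq (fun n => - c n).
Proof. by have [N cN] := dcompP c; exists N => n /cN ->; rewrite oppr0. Qed.

Lemma dscale_subproof a (c : dirsum) : finsupp_seq (fun n => a *: c n).
Proof. by have [N cN] := dcompP c; exists N => n /cN ->; rewrite scaler0. Qed.

Definition dzero := DirSum dzero_subproof.
Definition dadd c d := DirSum (dadd_subproof c d).
Definition dopp c := DirSum (dopp_subproof c).
Definition dscale a c := DirSum (dscale_subproof a c).

Lemma daddA : associative dadd.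
Proof. by move=> b c d; apply: dirsumP => n; apply: addrA. Qed.
Lemma daddC : commutative dadd.
Proof. by move=> c d; apply: dirsumP => n; apply: addrC. Qed.
Lemma dadd0 : left_id dzero dadd.
Proof. by move=> c; apply: dirsumP => n; apply: add0r. Qed.
Lemma daddN : left_inverse dzero dopp dadd.
Proof. by move=> c; apply: dirsumP => n; apply: addNr. Qed.

HB.instance Definition _ :=
  GRing.isZmodule.Build dirsum daddA daddC dadd0 daddN.

Lemma dscaleA a b c : dscale a (dscale b c) = dscale (a * b) c.
Proof. by apply: dirsumP => n; apply: scalerA. Qed.
Lemma dscale1 : left_id 1 dscale.
Proof. by move=> c; apply: dirsumP => n; apply: scale1r. Qed.
Lemma dscaleDr : right_distributive dscale +%R.
Proof. by move=> a c d; apply: dirsumP => n; apply: scalerDr. Qed.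
Lemma dscaleDl c : {morph dscale^~ c : a b / a + b}.
Proof. by move=> a b; apply: dirsumP => n; apply: scalerDl. Qed.

HB.instance Definition _ := GRing.Zmodule_isLmodule.Build R dirsum
  dscaleA dscale1 dscaleDr dscaleDl.

End DirectSum.

Section DirectSumMap.
Variables (R : pzRingType) (V W : nat -> lmodType R).
Variable h : forall n, {linear V n -> W n}.

Lemma dirsum_map_subproof (c : dirsum V) : finsupp_seq (fun n => h n (c n)).
Proof. by have [N cN] := dcompP c; exists N => n /cN ->; rewrite linear0. Qed.

Definition dirsum_map (c : dirsum V) : dirsum W := DirSum (dirsum_map_subproof c).

Lemma dirsum_map_is_linear : linear dirsum_map.
Proof. by move=> a c d; apply: dirsumP => n; apply: linearP. Qed.

HB.instance Definition _ := GRing.isLinear.Build R (dirsum V) (dirsum W) *:%R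
  dirsum_map dirsum_map_is_linear.

End DirectSumMap.

Section Chains.
Variables (R : comPzRingType) (X : digImg).

Definition dC (n : nat) := freemod R (cmap (dsimplex n) X).
HB.instance Definition _ n := GRing.Lmodule.on (dC n).

(** Indexed by the target degree: [bdry n] is the boundary map on
    [(n + 1)]-chains. *)
Definition bdry (n : nat) : dC n.+1 -> dC n :=
  flift (fun s : cmap (dsimplex n.+1) X =>
    \sum_(i < n.+2) (-1) ^+ i *: fbasis R (ccomp s (face i))).
HB.instance Definition _ n := GRing.Linear.on (@bdry n).

Definition cochain (n : nat) := dual (dC n).
HB.instance Definition _ n := GRing.Lmodule.on (cochain n).

Definition cobdry (n : nat) : cochain n -> cochain n.+1 :=
  dual_map (@bdry n).
HB.instance Definition _ n := GRing.Linear.on (@cobdry n).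

Definition cocycle_pred (n : nat) : {pred cochain n} :=
  fun c => cobdry c == 0.

Lemma cocycle_pred_closed n : submod_closed (@cocycle_pred n).
Proof.
split=> [|a c d /eqP c0 /eqP d0]; first by apply/eqP; apply: linear0.
by apply/eqP; rewrite linearP /= c0 d0 scaler0 addr0.
Qed.

HB.instance Definition _ n := GRing.isSubmodClosed.Build R (cochain n)
  (@cocycle_pred n) (@cocycle_pred_closed n).

Record cocycle (n : nat) := Cocycle {
  cocycle_val :> cochain n;
  cocycle_valP : cocycle_val \in @cocycle_pred n }.

HB.instance Definition _ n := [isSub for @cocycle_val n].
HB.instance Definition _ n := [Choice of cocycle n by <:].
HB.instance Definition _ n := [SubChoice_isSubLmodule of cocycle n by <:].

(** In degree [0] only [0] is a coboundary, since the boundary on 0-chains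
    is zero. *)
Definition coboundary_pred (n : nat) : {pred cocycle n} :=
  match n with
  | 0 => fun c => c == 0
  | n'.+1 => fun c => `[< exists b : cochain n', cobdry b = val c >]
  end.

Lemma coboundary_pred_closed n : submod_closed (@coboundary_pred n).
Proof.
case: n => [|n]; split=> /=.
- exact: eqxx.
- by move=> a c d /eqP -> /eqP ->; rewrite scaler0 addr0; apply: eqxx.
- by apply/asboolP; exists 0; rewrite linear0.
- move=> a c d /asboolP[b bc] /asboolP[b' bd]; apply/asboolP.
  by exists (a *: b + b'); rewrite linearP /= bc bd.
Qed.

HB.instance Definition _ n := GRing.isSubmodClosed.Build R (cocycle n)
  (@coboundary_pred n) (@coboundary_pred_closed n).

Definition dHn (n : nat) := quotmod (@coboundary_pred n).
HB.instance Definition _ n := GRing.Lmodule.on (dHn n).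

(** A class in [dH^*] may be inhomogeneous. *)
Definition dH := dirsum (fun n => dHn n : lmodType R).
HB.instance Definition _ := GRing.Lmodule.on dH.

End Chains.

Section Induced.
Variables (R : comPzRingType) (X Y : digImg) (f : cmap X Y).

Definition chain_map (n : nat) : dC R X n -> dC R Y n :=
  flift (fun s : cmap (dsimplex n) X => fbasis R (ccomp f s)).
HB.instance Definition _ n := GRing.Linear.on (@chain_map n).

Lemma bdry_chain_map n (c : dC R X n.+1) :
  bdry (chain_map c) = chain_map (bdry c).
Proof.
apply: (free_ext (f := bdry (n:=n) \o chain_map (n:=n.+1))
                 (g := chain_map (n:=n) \o bdry (n:=n))) => s /=.
rewrite /chain_map /bdry !flift_basis linear_sum; apply: eq_bigr => i _.
rewrite linearZ /= flift_basis; congr (_ *: fbasis _ _).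
by apply: cmapP => p; rewrite !ccompE.
Qed.

Definition cochain_map (n : nat) : cochain R Y n -> cochain R X n :=
  dual_map (@chain_map n).
HB.instance Definition _ n := GRing.Linear.on (@cochain_map n).

Lemma cobdry_cochain_map n (c : cochain R Y n) :
  cobdry (cochain_map c) = cochain_map (cobdry c).
Proof. by apply: dualP => b /=; rewrite bdry_chain_map. Qed.

Lemma cocycle_map_subproof n (c : cocycle R Y n) :
  cochain_map (val c) \in @cocycle_pred R X n.
Proof.
by apply/eqP; rewrite cobdry_cochain_map (eqP (valP c)) linear0.
Qed.

Definition cocycle_map n (c : cocycle R Y n) : cocycle R X n :=
  Cocycle (cocycle_map_subproof c).

Lemma cocycle_map_is_linear n : linear (@cocycle_map n).
Proof. by move=> a c d; apply: val_inj; rewrite /= linearP. Qed.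

HB.instance Definition _ n := GRing.isLinear.Build R (cocycle R Y n)
  (cocycle R X n) *:%R (@cocycle_map n) (@cocycle_map_is_linear n).

Lemma cocycle_map_coboundary n (c : cocycle R Y n) :
  c \in @coboundary_pred R Y n -> cocycle_map c \in @coboundary_pred R X n.
Proof.
case: n c => [|n] c; first by move=> /eqP ->; apply/eqP; apply: linear0.
move=> /asboolP[b bc]; apply/asboolP; exists (cochain_map b).
by rewrite cobdry_cochain_map bc.
Qed.

Definition dHn_map n (c : dHn R Y n) : dHn R X n :=
  qproj (@coboundary_pred R X n) (cocycle_map (qrepr c)).

Lemma dHn_mapE n (c : cocycle R Y n) :
  dHn_map (qproj (@coboundary_pred R Y n) c) =
  qproj (@coboundary_pred R X n) (cocycle_map c).
Proof.
apply/qprojP; rewrite -linearB; apply: cocycle_map_coboundary.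
exact/qprojP/qreprK.
Qed.

Lemma dHn_map_is_linear n : linear (@dHn_map n).
Proof.
move=> a c d; rewrite -(qreprK c) -(qreprK d) -linearP !dHn_mapE.
by rewrite !linearP.
Qed.

HB.instance Definition _ n := GRing.isLinear.Build R (dHn R Y n)
  (dHn R X n) *:%R (@dHn_map n) (@dHn_map_is_linear n).

Definition dH_map : dH R Y -> dH R X := dirsum_map (fun n => @dHn_map n).
HB.instance Definition _ := GRing.Linear.on dH_map.

End Induced.

Definition digital_primitive (R : comPzRingType) (k : prodAdj) (Y : digImg)
    (mY : cmap (pimg k Y Y) Y) (y : dH R Y) : Prop :=
  dH_map mY y = dH_map (cfst k Y Y) y + dH_map (csnd k Y Y) y.

(* Main.v *)
Require Import Defs.
From mathcomp Require Import all_boot all_algebra finmap.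

Set Implicit Arguments.
Unset Strict Implicit.
Unset Printing Implicit Defensive.

Import GRing.Theory.
Local Open Scope ring_scope.

(** Put h = (f x g) o Delta, so that the convolution is m_Y o h. Contravariant functoriality
    ([dH_map_ccomp]) and primitivity turn the left side into h^* applied to p_1^* y + p_2^* y. Since
    h^* is additive, functoriality read backwards gives the sum of the pullbacks of y along p_1 o h
    = f and p_2 o h = g. *)

Lemma chain_map_ccomp (R : comPzRingType) (X Y Z : digImg)
    (g : cmap Y Z) (f : cmap X Y) n (c : dC R X n) :
  chain_map (ccomp g f) c = chain_map g (chain_map f c).
Proof.
apply: (free_ext (f := @chain_map R X Z (ccomp g f) n)
  (g := @chain_map R Y Z g n \o @chain_map R X Y f n)) => s /=.
rewrite /chain_map !flift_basis; congr fbasis.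
by apply: cmapP => p; rewrite !ccompE.
Qed.

Lemma dH_map_ccomp (R : comPzRingType) (X Y Z : digImg)
    (g : cmap Y Z) (f : cmap X Y) (z : dH R Z) :
  dH_map (ccomp g f) z = dH_map f (dH_map g z).
Proof.
(* With each component written as the class of a cocycle, both sides are computed on that cocycle,
   whatever representatives [dHn_map] chooses. *)
apply: dirsumP => n /=; rewrite -(qreprK (z n)) !dHn_mapE.
congr (qproj _ _); apply: val_inj.
by apply: dualP => c /=; rewrite chain_map_ccomp.
Qed.

Lemma dH_mapD (R : comPzRingType) (X Y : digImg) (f : cmap X Y) :
  {morph @dH_map R X Y f : y z / y + z}.
Proof. exact: linearD. Qed.

Theorem theorem4p9 (R : comPzRingType) (k : prodAdj)
    (Y : digImg) (y0 : Y) (mY : cmap (pimg k Y Y) Y)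
    (hopfY : digital_hopf_space y0 mY)
    (X : digImg) (x0 : X) (f g : cmap X Y)
    (hf : f x0 = y0) (hg : g x0 = y0)
    (y : dH R Y) (hy : digital_primitive mY y) :
  dH_map (convolution mY f g) y = dH_map f y + dH_map g y.
Proof.
rewrite /convolution dH_map_ccomp hy.
rewrite dH_mapD -!dH_map_ccomp.
(* Pointwise, h sends x to the pair (f x, g x), whose projections are f x and g x. *)
by congr (dH_map _ y + dH_map _ y); apply: cmapP => x;
  rewrite !ccompE !mkcmapE ?(ppairK1, ppairK2).
Qed.
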